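(* Let $g:[0,\infty)\to[0,\infty)$ be any non-decreasing function with $g(0)=0$. For online single-machine preemptive scheduling where all jobs have the same density $w_j/p_j$, FIFO (always process the pending job with the earliest release time) is, for every $\epsilon>0$, $(1+\epsilon)$-speed $\frac{1+\epsilon}{\epsilon}$-competitive for the integral objective $\sum_j w_j g(C_j-r_j)$.
   Context: Job $j$ has release time $r_j\ge0$, processing time $p_j>0$, weight $w_j>0$, revealed at $r_j$. A schedule of speed $s$ assigns rates $x_j(t)\ge0$, $x_j(t)=0$ for $t<r_j$, $\sum_j x_j(t)\le s$; $C_j$ is the first time with $\int_{r_j}^{C_j}x_j=p_j$. An online algorithm (speed 1) is $\alpha$-speed $\beta$-competitive if its cost is at most $\beta$ times the minimum cost over offline schedules of speed $1/\alpha$. *)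

(* Defs.v *)
From HB Require Import structures.
From mathcomp Require Import all_boot all_order all_algebra.
From mathcomp Require Import all_classical all_reals all_analysis.
Set Implicit Arguments.
Unset Strict Implicit.
Unset Printing Implicit Defensive.
Import Order.TTheory GRing.Theory Num.Theory.
Import numFieldNormedType.Exports.
Local Open Scope classical_set_scope.
Local Open Scope ring_scope.

Record instance (R : realType) (n : nat) := Instance {
  release : 'I_n -> R;
  proc : 'I_n -> R;
  weight : 'I_n -> R;
  release_ge0 : forall j, 0 <= release j;
  proc_gt0 : forall j, 0 < proc j;
  weight_gt0 : forall j, 0 < weight j
}.

Section Scheduling.
Context {R : realType}.

Definition equal_density (n : nat) (I : instance R n) : Prop :=
  forall i j, weight I i / proc I i = weight I j / proc I j.

(* [x j t] is the rate at which job [j] is processed at time [t]. *)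
Definition rates (n : nat) : Type := 'I_n -> R -> R.

(* No bound on the work given to a single job is imposed: a job may still
   receive positive rate after its completion. *)
Definition schedule (s : R) (n : nat) (I : instance R n) (x : rates n) : Prop :=
  [/\ forall j, measurable_fun setT (x j),
      forall j t, 0 <= x j t,
      forall j t, t < release I j -> x j t = 0 &
      forall t, \sum_(j < n) x j t <= s].

Definition work (n : nat) (I : instance R n) (x : rates n) (j : 'I_n) (t : R)
    : \bar R :=
  (\int[lebesgue_measure]_(u in `[release I j, t]) (x j u)%:E)%E.

(* [C j] is the first time at which the work done on [j] equals [proc I j];
   in particular every job is completed in finite time. *)
Definition completion_times (n : nat) (I : instance R n) (x : rates n)
    (C : 'I_n -> R) : Prop :=
  forall j, [/\ release I j <= C j,
                work I x j (C j) = (proc I j)%:E &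
                forall t, release I j <= t -> work I x j t = (proc I j)%:E ->
                  C j <= t].

Definition cost (g : R -> R) (n : nat) (I : instance R n) (C : 'I_n -> R) : R :=
  \sum_(j < n) weight I j * g (C j - release I j).

(* The infimum is taken in the extended reals so that it has no junk value
   on the empty set. *)
Definition opt_cost (g : R -> R) (s : R) (n : nat) (I : instance R n) : \bar R :=
  ereal_inf [set (cost g I C)%:E | C in
    [set C | exists2 x, schedule s I x & completion_times I x C]].

Definition pending (n : nat) (I : instance R n) (x : rates n) (t : R)
    (j : 'I_n) : Prop :=
  release I j <= t /\ (work I x j t < (proc I j)%:E)%E.

Definition earliest_pending (n : nat) (I : instance R n) (x : rates n) (t : R)
    (j : 'I_n) : Prop :=
  pending I x t j /\
  forall k, pending I x t k -> release I j <= release I k.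

(* The rule at time [t] only looks at jobs released by time [t] and at the work
   they received before [t], so it is an online rule. Ties between equal
   release times may be broken arbitrarily, and differently at different
   times. *)
Definition fifo (n : nat) (I : instance R n) (x : rates n) : Prop :=
  [/\ schedule 1 I x,
      forall t, (exists j, pending I x t j) ->
        exists2 j, earliest_pending I x t j & x j t = 1 &
      forall t, (forall j, ~ pending I x t j) -> forall j, x j t = 0].

(* An algorithm [A] is given by the schedules that it may produce on each
   instance (several, if ties are broken arbitrarily); it must produce at least
   one, and the cost guarantee holds for all of them. [P] is the class of
   instances considered. *)
Definition speed_competitive
    (A : forall n, instance R n -> rates n -> Prop)
    (P : forall n, instance R n -> Prop) (g : R -> R) (alpha beta : R) : Prop :=
  forall (n : nat) (I : instance R n), P n I ->
    (exists x, A n I x) /\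
    forall x, A n I x ->
      schedule 1 I x /\
      exists2 C, completion_times I x C &
        ((cost g I C)%:E <= beta%:E * opt_cost g alpha^-1 I)%E.

End Scheduling.

(* Main.v *)
(** Every job [j] lies in a FIFO busy period, starting at some release time [a];
    throughout [[a, C j]] FIFO works only on jobs released in [[a, r j]], so
    [C j - a] is at most their total volume [V].  If [y <= g (C j - r j)], then
    every job of this window with [g]-cost below [y] in the slower schedule is
    finished there by [C j], and such jobs have total volume at most
    [(C j - a) / (1 + eps) <= V / (1 + eps)].  Hence the slower schedule incurs
    cost at least [y] on a fraction [eps / (1 + eps)] of the volume of the
    window.  Covering the FIFO jobs of cost at least [y] by disjoint windows
    compares the volumes at each level [y]; equal densities turn volume into
    weight, and a layer-cake summation over [y] compares the costs. *)
Require Import Defs.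
From HB Require Import structures.
From mathcomp Require Import all_boot all_order all_algebra.
From mathcomp Require Import all_classical all_reals all_analysis.
From mathcomp Require Import lra.
Set Implicit Arguments.
Unset Strict Implicit.
Unset Printing Implicit Defensive.
Import Order.TTheory GRing.Theory Num.Theory.
Import numFieldNormedType.Exports.
Local Open Scope classical_set_scope.
Local Open Scope ring_scope.

(** * Volume processed by a bounded measurable rate *)

Section BoundedRates.
Context {R : realType}.
Implicit Types (f : R -> R) (a b c s t u : R).

Let mu := @lebesgue_measure R.

Definition bounded_rate s f :=
  measurable_fun setT f /\ forall t, 0 <= f t <= s.

Definition volume f a b : R := \int[mu]_(u in `[a, b]) f u.

Lemma itv_measure_finite a b (x y : bool) :
  (mu [set` Interval (BSide x a) (BSide y b)] < +oo)%E.
Proof.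
by rewrite /mu lebesgue_measure_itv/=; case: ifP => // _; rewrite ltry.
Qed.

Lemma rate_integrable s f a b (x y : bool) : bounded_rate s f ->
  mu.-integrable [set` Interval (BSide x a) (BSide y b)] (EFin \o f).
Proof.
move=> [mf bf]; apply: measurable_bounded_integrable => //.
- exact: itv_measure_finite.
- exact: measurable_funS mf.
exists s; split; first by rewrite num_real.
move=> M sM u _ /=; have /andP[f0 fs] := bf u.
by rewrite ger0_norm// (le_trans fs)// ltW.
Qed.

Lemma integral_volume s f a b : bounded_rate s f ->
  (\int[mu]_(u in `[a, b]) (f u)%:E)%E = (volume f a b)%:E.
Proof.
move=> bf; rewrite /volume /Rintegral fineK//.
apply: integrable_fin_num => //; exact: (rate_integrable _ _ _ _ bf).
Qed.

Lemma volume_ge0 s f a b : bounded_rate s f -> 0 <= volume f a b.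
Proof. by move=> [_ bf]; apply: Rintegral_ge0 => u _; case/andP: (bf u). Qed.

Lemma volume_cat s f a b c : bounded_rate s f -> a <= b -> b <= c ->
  volume f a c = volume f a b + volume f b c.
Proof.
move=> bf ab bc; apply/eqP; rewrite addrC -subr_eq; apply/eqP.
rewrite /volume (Rintegral_itvB (x := b)) ?bnd_simp//; last first.
  exact: (rate_integrable _ _ _ _ bf).
rewrite Rintegral_itv_obnd_cbnd//; exact: (rate_integrable _ _ _ _ bf).
Qed.

Lemma volume_pt f a : volume f a a = 0.
Proof. by rewrite /volume set_itv1 Rintegral_set1. Qed.

Lemma volume_cst a b c : a <= b ->
  \int[mu]_(u in `[a, b[) (fun _ => c) u = c * (b - a).
Proof.
move=> ab; rewrite Rintegral_cst//= /mu lebesgue_measure_itv/= lte_fin.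
by case: ltgtP ab => // -> _; rewrite /= subrr.
Qed.

Lemma cst_integrable a b c : mu.-integrable `[a, b[ (EFin \o fun=> c).
Proof.
apply: measurable_bounded_integrable => //; first exact: itv_measure_finite.
exists `|c|; split; first by rewrite num_real.
by move=> M cM u _ /=; rewrite ltW.
Qed.

(** The bound is asked only on [[a, b[], as one point has measure zero; this suits jobs, which are
    pending on half-open intervals. *)
Lemma volume_le s f a b c : bounded_rate s f -> a <= b ->
  (forall u, a <= u < b -> f u <= c) -> volume f a b <= c * (b - a).
Proof.
move=> bf ab fc.
rewrite -volume_cst// /volume -Rintegral_itv_bndo_bndc; last first.
  exact: (rate_integrable _ _ _ _ bf).
apply: le_Rintegral => //.
- exact: (rate_integrable _ _ _ _ bf).
- exact: cst_integrable.
Qed.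

Lemma volume_ge s f a b c : bounded_rate s f -> a <= b ->
  (forall u, a <= u < b -> c <= f u) -> c * (b - a) <= volume f a b.
Proof.
move=> bf ab fc.
rewrite -volume_cst// /volume -Rintegral_itv_bndo_bndc; last first.
  exact: (rate_integrable _ _ _ _ bf).
apply: le_Rintegral => //.
- exact: cst_integrable.
- exact: (rate_integrable _ _ _ _ bf).
Qed.

Lemma volume_mono s f a b c : bounded_rate s f -> a <= b -> b <= c ->
  volume f a b <= volume f a c.
Proof.
move=> bf ab bc.
by rewrite [leRHS](volume_cat bf ab bc) lerDl (volume_ge0 _ _ bf).
Qed.

Lemma volume_lip s f a b c : bounded_rate s f -> a <= b -> b <= c ->
  volume f a c <= volume f a b + s * (c - b).
Proof.
move=> bf ab bc; rewrite (volume_cat bf ab bc) lerD2l.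
by apply: (volume_le bf bc) => u _; case/andP: (bf.2 u).
Qed.

Lemma volume_startl f a b t : a <= b ->
  (forall u, a <= u < b -> f u = 0) -> volume f a t = volume f b t.
Proof.
move=> ab f0; rewrite /volume Rintegral_mkcond [RHS]Rintegral_mkcond.
congr Rintegral; apply/funext => u; rewrite !patchE !mem_setE !in_itv/=.
have [ub|bu] := ltP u b; last by rewrite (le_trans ab bu).
by case: (leP a u) => //= au; rewrite f0 ?au ?ub//; case: ifP.
Qed.

Lemma volume_sum (I : finType) (P : pred I) (F : I -> R -> R) s a b :
  (forall i, bounded_rate s (F i)) ->
  volume (fun u => \sum_(i | P i) F i u) a b = \sum_(i | P i) volume (F i) a b.
Proof.
move=> bF; apply: EFin_inj; rewrite -sumEFin.
rewrite /volume /Rintegral.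
under eq_integral do rewrite -sumEFin.
rewrite integral_sum//; last by move=> i; apply: (rate_integrable _ _ _ _ (bF i)).
rewrite fineK.
  by apply: eq_bigr => i _; rewrite (integral_volume _ _ (bF i)).
apply/sum_fin_numP => i _ _.
by rewrite (integral_volume _ _ (bF i)).
Qed.

End BoundedRates.

(** * Work and completion in a schedule of given speed *)

Section Schedules.
Context {R : realType} (n : nat) (I : instance R n).
Local Notation r := (release I).
Local Notation p := (proc I).

Section AnySpeed.
Variables (s : R) (x : @rates R n).
Hypothesis xS : schedule s I x.

Lemma schedule_rate j : bounded_rate s (x j).
Proof.
have [mx x0 _ xs] := xS; split=> // t; rewrite x0/=.
by apply: le_trans (xs t); rewrite (bigD1 j)//= lerDl sumr_ge0.
Qed.

Lemma schedule_sum_rate (P : pred 'I_n) :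
  bounded_rate s (fun t => \sum_(j | P j) x j t).
Proof.
have [mx x0 _ xs] := xS; split.
  under eq_fun do rewrite big_mkcond/=.
  by apply: measurable_sum => j; case: (P j).
move=> t; rewrite sumr_ge0//=; apply: le_trans (xs t).
by rewrite [leRHS](bigID P)/= lerDl sumr_ge0.
Qed.

Lemma work_volume j t : work I x j t = (volume (x j) (r j) t)%:E.
Proof. exact: integral_volume (schedule_rate j). Qed.

Lemma volume_release j a t : a <= r j ->
  volume (x j) a t = volume (x j) (r j) t.
Proof.
move=> ar; apply: volume_startl => // u /andP[_ ur].
by case: xS => _ _ + _; apply.
Qed.

Lemma pendingE j t :
  pending I x t j <-> r j <= t /\ volume (x j) (r j) t < p j.
Proof. by rewrite /pending work_volume lte_fin. Qed.

(** Each job of [P] receives its whole processing time inside [[a, t]], where speed [s] has room for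
    [s * (t - a)] in total. *)
Lemma completed_volume (C : 'I_n -> R) a t (P : pred 'I_n) :
  completion_times I x C -> a <= t ->
  (forall j, P j -> a <= r j /\ C j <= t) ->
  \sum_(j | P j) p j <= s * (t - a).
Proof.
move=> xC le_at Pat.
have := volume_le (schedule_sum_rate P) le_at (c := s).
rewrite (volume_sum _ _ _ schedule_rate) => vol_le.
apply: le_trans (vol_le _); last first.
  by move=> u _; case/andP: ((schedule_sum_rate P).2 u).
apply: ler_sum => j /Pat[ar Ct]; have [rC + _] := xC j.
rewrite work_volume => -[<-]; rewrite volume_release//.
exact: volume_mono (schedule_rate j) rC Ct.
Qed.

End AnySpeed.

(** * Completion times and busy periods of FIFO *)

Section Fifo.
Variable x : @rates R n.
Hypothesis xF : fifo I x.

Let xS : schedule 1 I x. Proof. by case: xF. Qed.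
Let xB := schedule_rate xS.

(** If some job is pending, the one chosen by FIFO already uses the whole speed 1. *)
Lemma fifo_rate0 k t : ~ pending I x t k -> x k t = 0.
Proof.
have [_ x0 _ xs] := xS; have [_ Fbusy Fidle] := xF => kN.
have [/Fbusy[j [jP _] xj1]|noP] := pselect (exists j, pending I x t j).
  have kj : k != j by apply/eqP => kj; apply: kN; rewrite kj.
  apply/eqP; rewrite eq_le x0 andbT.
  have := xs t; rewrite (bigD1 j)//= (bigD1 k)//= xj1.
  rewrite gerDl => sum_le; apply: le_trans sum_le.
  by rewrite lerDl sumr_ge0.
by apply: Fidle => j jP; apply: noP; exists j.
Qed.

(** The volume is 1-Lipschitz and, by [fifo_rate0], stops growing after [sup E], so it cannot
    overshoot. *)
Lemma fifo_volume_release k t : r k <= t -> volume (x k) (r k) t <= p k.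
Proof.
move=> rt; rewrite leNgt; apply/negP => ltpv.
pose v u := volume (x k) (r k) u.
pose E := [set u | r k <= u <= t /\ v u < p k].
have Er : E (r k) by split; rewrite ?lexx ?rt// /v volume_pt proc_gt0.
have Esup : has_sup E.
  by split; [exists (r k)|exists t => u [/andP[]]].
(* Half of the supposed excess. Some [u1] in [E] lies within [e] of [sup E]; from there to
   [sup E + e] the volume grows by less than [2 * e], so it stays below [v t]. *)
pose e := (v t - p k) / 2.
have e0 : 0 < e by rewrite divr_gt0// subr_gt0.
have [u1 [/andP[ru1 u1t] vu1] lt_u1] := sup_adherent e0 Esup.
have u1sup : u1 <= sup E.
  by apply: sup_ubound => //; [exact: Esup.2|split=> //; rewrite ru1].
have lip u : u1 <= u -> v u < p k + (u - u1).
  move=> /(volume_lip (xB k) ru1); rewrite mul1r => /le_lt_trans; apply.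
  by rewrite ltrD2r.
have [tle|lte] := leP t (sup E + e).
  by have := lip _ u1t; rewrite /e in lt_u1 tle *; lra.
have : v t <= v (sup E + e).
  rewrite /v (volume_cat (xB k) (b := sup E + e)); last 2 first.
  - lra.
  - exact: ltW.
  rewrite gerDl -[leRHS](mul0r (t - (sup E + e))).
  apply: (volume_le (xB k)) => [|u /andP[leu ut]]; first exact: ltW.
  rewrite fifo_rate0// => /(pendingE xS)[ru vu].
  have : u <= sup E.
    by apply: sup_ubound; [exact: Esup.2|split; rewrite ?ru ?(ltW ut)].
  lra.
have := lip (sup E + e).
rewrite /e in lt_u1 lte *; lra.
Qed.

Lemma fifo_volume k a t : volume (x k) a t <= p k.
Proof.
have v0 b : t < b -> volume (x k) b t = 0.
  by move=> tb; rewrite /volume set_itv_ge ?Rintegral_set0// bnd_simp -ltNge.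
have p0 := ltW (proc_gt0 I k).
have [tr|rt] := ltP t (r k); have [ar|ra] := leP a (r k).
- by rewrite (volume_release xS) ?v0.
- by rewrite v0// (lt_trans tr).
- by rewrite (volume_release xS)// fifo_volume_release.
have [ta|le_at] := ltP t a; first by rewrite v0.
apply: le_trans (fifo_volume_release rt).
by rewrite (volume_cat (xB k) (ltW ra))// lerDr (volume_ge0 _ _ (xB k)).
Qed.

(** The jobs of [P] get total rate at least 1 throughout, and none absorbs more than its processing
    time. *)
Lemma fifo_busy_volume (P : pred 'I_n) a b : a <= b ->
  (forall u, a <= u < b -> exists2 k, P k & x k u = 1) ->
  b - a <= \sum_(k | P k) p k.
Proof.
move=> ab busy; have [_ x0 _ _] := xS.
have vge : 1 * (b - a) <= volume (fun u => \sum_(k | P k) x k u) a b.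
  apply: (volume_ge (schedule_sum_rate xS P) ab) => u /busy[k Pk xk].
  by rewrite (bigD1 k)//= xk lerDl sumr_ge0.
rewrite mul1r in vge; apply: le_trans vge _.
by rewrite (volume_sum _ _ _ xB); apply: ler_sum => k _; apply: fifo_volume.
Qed.

Lemma fifo_completes j : exists2 t, r j <= t & volume (x j) (r j) t = p j.
Proof.
have [_ Fbusy _] := xF; apply: contrapT => never.
(* An unfinished [j] would keep FIFO busy from [r j] until this time, one unit longer than the total
   processing time. *)
pose t := r j + \sum_k p k + 1.
have sp0 : 0 <= \sum_k p k by apply: sumr_ge0 => k _; apply/ltW/proc_gt0.
have : t - r j <= \sum_(k | xpredT k) p k.
  apply: fifo_busy_volume => [|u /andP[ru _]]; first by rewrite /t; lra.
  have [|k _ xk1] := Fbusy u; last by exists k.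
  exists j; apply/(pendingE xS); split=> //.
  rewrite lt_neqAle fifo_volume andbT; apply/eqP => vE.
  by apply: never; exists u.
rewrite /t; lra.
Qed.

Lemma fifo_completion_times : exists C, completion_times I x C.
Proof.
suff /choice[C xC] : forall j, exists c, [/\ r j <= c,
    work I x j c = (p j)%:E &
    forall t, r j <= t -> work I x j t = (p j)%:E -> c <= t] by exists C.
move=> j.
pose E := [set t | r j <= t /\ volume (x j) (r j) t = p j].
have [T rT vT] := fifo_completes j.
have Einf : has_inf E by split; [exists T | exists (r j) => u []].
have rE : r j <= inf E by apply: lb_le_inf; [exists T | move=> u []].
exists (inf E); split => //; last first.
  move=> t rt; rewrite (work_volume xS) => -[vt].
  by apply: ge_inf => //; exact: Einf.2.
(* The infimum is attained: a time in [E] within [e] of it shows, by the Lipschitz bound, that at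
   most [e] of work is missing there. *)
rewrite (work_volume xS); congr EFin; apply/eqP.
rewrite eq_le fifo_volume/=; apply/ler_addgt0Pr => e e0.
have [u [ru vu] ue] := inf_adherent e0 Einf.
have Eu : inf E <= u by apply: ge_inf => //; exact: Einf.2.
rewrite -vu; apply: le_trans (volume_lip (xB j) rE Eu) _.
by rewrite mul1r lerD2l; lra.
Qed.

Variable C : 'I_n -> R.
Hypothesis xC : completion_times I x C.

Lemma fifo_pendingE t j : pending I x t j <-> r j <= t < C j.
Proof.
have [rC + Cmin] := xC j; rewrite (work_volume xS) => -[vC].
split=> [/(pendingE xS)[rt vt]|/andP[rt tC]].
  rewrite rt ltNge; apply/negP => Ct.
  by have := volume_mono (xB j) rC Ct; rewrite vC leNgt vt.
apply/(pendingE xS); split=> //; rewrite lt_neqAle fifo_volume andbT.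
apply/eqP => vt; suff : C j <= t by rewrite leNgt tC.
by apply: Cmin => //; rewrite (work_volume xS) vt.
Qed.

(* [r i] is the start of the busy period of [j]: the last release time up to
   [r j] at which no job released earlier is pending. *)
Lemma fifo_busy_period j : exists2 i, r i <= r j &
  C j - r i <= \sum_(k | r i <= r k <= r j) p k.
Proof.
have [_ Fbusy _] := xF.
(* Fresh releases are those that can start a busy period. The earliest release is vacuously fresh,
   so a latest fresh one up to [r j] exists. *)
pose fresh i := [forall k, (r k < r i) ==> (C k <= r i)].
have [i0 _ i0min] := @arg_minP _ _ _ j xpredT r isT.
have fi0 : (r i0 <= r j) && fresh i0.
  by rewrite i0min//; apply/forallP => k; rewrite ltNge i0min.
have [i /andP[rij /forallP fi] imax] :=
  @arg_maxP _ _ _ i0 (fun i => (r i <= r j) && fresh i) r fi0.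
exists i => //; have [rCj _ _] := xC j.
apply: fifo_busy_volume => [|u /andP[iu uj]]; first exact: le_trans rCj.
have [|k [kP kmin] xk1] := Fbusy u; last first.
  exists k => //; have /fifo_pendingE/andP[rku uk] := kP.
  apply/andP; split.
    rewrite leNgt; apply/negP => rki; have /implyP/(_ rki) := fi k.
    by move=> /le_trans/(_ iu); rewrite leNgt uk.
  have [rju|/ltW ujr] := leP (r j) u; last exact: le_trans ujr.
  by apply: kmin; apply/fifo_pendingE; rewrite rju.
(* If FIFO were idle at [u], the first release after [u] would be fresh, later than [r i] and at
   most [r j], against the choice of [i]. *)
apply: contrapT => noP.
have donek k : r k <= u -> C k <= u.
  move=> rk; rewrite leNgt; apply/negP => uC.
  by apply: noP; exists k; apply/fifo_pendingE; rewrite rk.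
have urj : u < r j.
  by rewrite ltNge; apply/negP => /donek; rewrite leNgt uj.
have [i' ui' i'min] := @arg_minP _ _ _ j (fun k => u < r k) r urj.
suff /imax : (r i' <= r j) && fresh i' by rewrite /= leNgt (le_lt_trans iu).
rewrite i'min//=; apply/forallP => k; apply/implyP => ki'.
apply: le_trans (ltW ui'); apply: donek; rewrite leNgt; apply/negP => /i'min.
by rewrite leNgt ki'.
Qed.

End Fifo.
End Schedules.

(** * Existence of a FIFO schedule *)

Section FifoExists.
Context {R : realType} (n : nat) (I : instance R n).
Local Notation r := (release I).
Local Notation p := (proc I).

(** Breaking ties by index makes the release order strict and total. *)
Let before (i j : 'I_n) := (r i < r j) || ((r i == r j) && (i < j)%N).

Let before_irr i : ~~ before i i.
Proof. by rewrite /before ltxx ltnn andbF. Qed.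

Let before_trans i j k : before i j -> before j k -> before i k.
Proof.
rewrite /before => /orP[ij|/andP[/eqP-> ij]] /orP[jk|/andP[/eqP<- jk]].
- by rewrite (lt_trans ij).
- by rewrite ij.
- by rewrite jk.
- by rewrite eqxx (ltn_trans ij) ?orbT.
Qed.

Let before_total i j : i != j -> before i j || before j i.
Proof.
by rewrite /before -val_eqE neq_ltn; case: (ltgtP (r i) (r j)).
Qed.

Let before_release i j : before i j -> r i <= r j.
Proof. by move=> /orP[/ltW//|/andP[/eqP->]]. Qed.

(** These are the start times when jobs run one by one, without preemption, in the order [before];
    the last clause rules out needless idling. *)
Lemma fifo_starts : exists S : 'I_n -> R, forall j,
  [/\ r j <= S j, forall i, before i j -> S i + p i <= S j &
      forall t, r j <= t -> (forall i, before i j -> S i + p i <= t) -> S j <= t].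
Proof.
(* The recursion has stabilised after [m] rounds for jobs with at most [m] predecessors, hence after
   [n] rounds for all. *)
pose S := fix S m j := if m is m'.+1
  then \big[Num.max/r j]_(i | before i j) (S m' i + p i) else r j.
have Sstable m : forall j, (#|[pred i | before i j]| <= m)%N ->
    S m.+1 j = S m j.
  elim: m => [|m IH] j.
    rewrite leqn0 => /eqP/card0_eq nob /=.
    by rewrite big_pred0// => i; exact: nob.
  move=> jm; apply: eq_bigr => i ij; congr (_ + _); apply: IH.
  rewrite -ltnS; apply: leq_trans jm; apply: proper_card; apply/properP; split.
    by apply/fintype.subsetP => k; rewrite !inE => /before_trans; apply.
  by exists i; rewrite !inE//= (negbTE (before_irr i)).
exists (S n) => j.
have -> : S n j = S n.+1 j by rewrite Sstable// -[leqRHS]card_ord max_card.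
split=> [|i ij|t rt ijt] /=.
- exact: bigmax_ge_id.
- exact: (le_bigmax_cond _ (fun i => S n i + p i)).
- exact/bigmax_leP.
Qed.

Lemma fifo_exists : exists x, fifo I x.
Proof.
have [S Sspec] := fifo_starts.
pose act j t := S j <= t < S j + p j.
pose x : rates n := fun j t => (act j t)%:R.
have act_inj t i j : act i t -> act j t -> i = j.
  move=> /andP[iS iE] /andP[jS jE]; apply/eqP; apply: contraT.
  move=> /before_total/orP[ij|ji].
    by have [_ /(_ _ ij) le_S _] := Sspec j; lra.
  by have [_ /(_ _ ji) le_S _] := Sspec i; lra.
have xS : schedule 1 I x.
  split.
  - move=> j; rewrite (_ : x j = \1_`[S j, S j + p j[).
      exact: measurable_realfun.measurable_indic.
    by apply/funext => t; rewrite indicE mem_setE in_itv.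
  - by move=> j t; rewrite ler0n.
  - move=> j t tr; rewrite /x /act; have [rS _ _] := Sspec j.
    by rewrite leNgt (lt_le_trans tr rS).
  move=> t; have [/existsP[j jt]|/existsPn noact] := boolP [exists j, act j t].
    rewrite (bigD1 j)//= /x jt big1 ?addr0// => i ij.
    by case: (boolP (act i t)) => // /act_inj/(_ jt) /eqP; rewrite (negbTE ij).
  by rewrite big1// => j _; rewrite /x (negbTE (noact j)).
have xB := schedule_rate xS.
have pendE j t : pending I x t j <-> r j <= t < S j + p j.
  have [rS _ _] := Sspec j; have p0 := proc_gt0 I j.
  have vr u : volume (x j) (r j) u = volume (x j) (S j) u.
    apply: volume_startl => // v /andP[_ vS].
    by rewrite /x /act leNgt vS.
  split=> [/(pendingE xS)[rt]|/andP[rt tE]].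
    rewrite vr rt => /=; apply: contraTT; rewrite -!leNgt => tE.
    have vge : 1 * (S j + p j - S j) <= volume (x j) (S j) (S j + p j).
      apply: (volume_ge (xB j)) => [|u uS]; first by lra.
      by rewrite /x /act uS.
    apply: le_trans (volume_mono (xB j) _ tE); last by lra.
    by apply: le_trans vge; lra.
  apply/(pendingE xS); split=> //; rewrite vr.
  have [St|tS] := leP (S j) t.
    have := volume_lip (xB j) (lexx (S j)) St; rewrite volume_pt; lra.
  by rewrite /volume set_itv_ge ?Rintegral_set0// bnd_simp -ltNge.
exists x; split=> // [t [j0 /pendE j0P]|t noP j]; last first.
  have [rS _ _] := Sspec j.
  rewrite /x; case: (boolP (act j t)) => // /andP[St tE].
  by case: (noP j); apply/pendE; rewrite tE (le_trans rS).
pose pend j := r j <= t < S j + p j.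
pose rk j := #|[pred i | before i j]|.
(* All predecessors of a pending job with fewest predecessors are finished, so the minimality of
   [S j] puts [j] in its running interval. *)
have [j jP jmin] := @arg_minnP _ j0 pend rk j0P.
have first i : before i j -> ~~ pend i.
  move=> ij; apply/negP => /jmin; rewrite leqNgt => /negP; apply.
  apply: proper_card; apply/properP; split.
    by apply/fintype.subsetP => k; rewrite !inE => /before_trans; apply.
  by exists i; rewrite !inE//= (negbTE (before_irr i)).
have /andP[rt tE] := jP.
exists j; last first.
  rewrite /x /act tE andbT; have [_ _ ->//] := Sspec j.
  move=> i ij; have := first _ ij.
  by rewrite /pend (le_trans (before_release ij))//= -leNgt.
split; first exact/pendE.
move=> k /pendE kP; have [->//|] := eqVneq j k.
move=> /before_total/orP[/before_release//|/first]; by rewrite /pend kP.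
Qed.

End FifoExists.

(** * Layer-cake and covering inequalities for finite sums *)

(** Induction on the number of positive values of [a]: the least of them, [y], is subtracted from
    [a] and [b] with truncation at 0, and the layer removed is compared by the hypothesis at [y]. *)
Lemma weighted_level_le (R : realType) (T : finType) (p a b : T -> R)
    (alpha beta : R) :
  (forall k, 0 <= p k) -> (forall k, 0 <= a k) -> (forall k, 0 <= b k) ->
  0 <= beta ->
  (forall y, 0 < y ->
    alpha * \sum_(k | y <= a k) p k <= beta * \sum_(k | y <= b k) p k) ->
  alpha * \sum_k p k * a k <= beta * \sum_k p k * b k.
Proof.
move=> p0 + + beta0; have [m] := ubnP #|[pred k | 0 < a k]|.
elim: m a b => // m IH a b am a0 b0 level.
have [k0 k0P|a_eq0] := pickP [pred k | 0 < a k]; last first.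
  have -> : \sum_k p k * a k = 0.
    apply: big1 => k _; have /= := a_eq0 k.
    by rewrite lt_neqAle a0 andbT => /negbFE/eqP <-; rewrite mulr0.
  by rewrite mulr0 mulr_ge0// sumr_ge0// => k _; rewrite mulr_ge0.
have [j /= j0 jmin] := @arg_minP _ _ _ k0 [pred k | 0 < a k] a k0P.
set y := a j in j0 jmin.
pose a' k := Num.max (a k - y) 0; pose b' k := Num.max (b k - y) 0.
have le_max0 (c z : R) : 0 < z -> (z <= Num.max (c - y) 0) = (z + y <= c).
  by move=> z0; rewrite le_max lerBrDr [z <= 0]leNgt z0 orbF.
(* An equality, since no value of [a] lies strictly between 0 and [y]. *)
have aE : \sum_k p k * a k = \sum_k p k * a' k + y * \sum_(k | y <= a k) p k.
  rewrite mulr_sumr [X in _ + X]big_mkcond -big_split/=; apply: eq_bigr => k _.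
  rewrite /a' maxEle lerBlDr add0r; have [yk|ky] := leP y (a k).
    have [ayk|_] := leP (a k) y; last by rewrite mulrBr [y * _]mulrC subrK.
    have -> : a k = y by apply/le_anti; rewrite ayk.
    by rewrite mulr0 add0r mulrC.
  have [ak0|ak0] := ltP 0 (a k); first by have := jmin _ ak0; rewrite leNgt ky.
  have -> : a k = 0 by apply/le_anti; rewrite ak0 a0.
  by rewrite (ltW j0) !mulr0 addr0.
(* Only an inequality: values of [b] strictly between 0 and [y] are dropped. *)
have bE : \sum_k p k * b' k + y * \sum_(k | y <= b k) p k <= \sum_k p k * b k.
  rewrite mulr_sumr [X in _ + X]big_mkcond -big_split/=; apply: ler_sum => k _.
  rewrite /b' maxEle lerBlDr add0r; have [yk|ky] := leP y (b k).
    have [byk|_] := leP (b k) y; last by rewrite mulrBr [y * _]mulrC subrK.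
    by rewrite mulr0 add0r mulrC ler_wpM2l.
  by rewrite (ltW ky) mulr0 addr0 mulr_ge0.
have {}IH : alpha * \sum_k p k * a' k <= beta * \sum_k p k * b' k.
  apply: IH => [|k|k|z z0]; rewrite /a' /b' ?le_max ?lexx ?orbT//.
    rewrite -ltnS; apply: leq_trans am; rewrite ltnS.
    apply: proper_card; apply/properP; split.
      apply/fintype.subsetP => k; rewrite !inE lt_max ltxx orbF subr_gt0.
      exact: lt_trans.
    by exists j; rewrite !inE//= -/y subrr maxxx ltxx.
  under eq_bigl do rewrite le_max0//.
  under [X in _ <= _ * X]eq_bigl do rewrite le_max0//.
  by apply: level; rewrite addr_gt0.
rewrite aE mulrDr; apply: le_trans (ler_wpM2l beta0 bE); rewrite mulrDr.
apply: lerD => //; rewrite ![_ * (y * _)]mulrCA.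
by apply: ler_wpM2l; [exact: ltW | exact: level].
Qed.

(* Greedily peels off disjoint release windows, starting from the [A]-job
   released last. *)
Lemma window_cover_le (R : realType) (T : finType) (r p : T -> R) (A B : pred T)
    (alpha beta : R) :
  (forall k, 0 <= p k) -> 0 <= alpha -> 0 <= beta ->
  (forall j, A j -> exists2 i, r i <= r j &
    alpha * \sum_(k | r i <= r k <= r j) p k <=
    beta * \sum_(k | (r i <= r k <= r j) && B k) p k) ->
  alpha * \sum_(k | A k) p k <= beta * \sum_(k | B k) p k.
Proof.
move=> p0 alpha0 beta0 window.
suff cut t : alpha * \sum_(k | A k && (r k < t)) p k <=
    beta * \sum_(k | B k && (r k < t)) p k.
  pose t := \sum_k `|r k| + 1.
  have rt k : r k < t.
    rewrite /t (bigD1 k)//= -addrA ltr_pwDr ?ler_norm//.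
    by rewrite ltr_wpDl// sumr_ge0.
  have := cut t; under eq_bigl do rewrite rt andbT.
  by under [X in _ <= _ * X]eq_bigl do rewrite rt andbT.
have [m] := ubnP #|[pred k | r k < t]|; elim: m t => // m IH t tm.
have [j0 j0P|noA] := pickP [pred k | A k && (r k < t)]; last first.
  rewrite (big_pred0 _ _ _ _ noA).
  by rewrite mulr0 mulr_ge0// sumr_ge0.
have [j /= /andP[jA jt] jmax] :=
  @arg_maxP _ _ _ j0 [pred k | A k && (r k < t)] r j0P.
have [i rij win] := window j jA.
have it := le_lt_trans rij jt.
have {}IH := IH (r i).
(* By maximality of [r j], an [A]-job released before [t] but not before [r i] lies in the
   window. *)
have Asplit : \sum_(k | A k && (r k < t)) p k <=
    \sum_(k | A k && (r k < r i)) p k + \sum_(k | r i <= r k <= r j) p k.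
  rewrite big_mkcond [X in _ <= X + _]big_mkcond [X in _ <= _ + X]big_mkcond.
  rewrite -big_split/=; apply: ler_sum => k _.
  have [/= kP|_] := boolP (A k && (r k < t)); last by apply: addr_ge0; case: ifP.
  have rkj : r k <= r j := jmax k kP.
  have /andP[-> _] := kP; rewrite rkj andbT /=.
  by case: (leP (r i) (r k)) => _; rewrite ?add0r ?addr0.
have Bsplit : \sum_(k | B k && (r k < r i)) p k +
    \sum_(k | (r i <= r k <= r j) && B k) p k <= \sum_(k | B k && (r k < t)) p k.
  rewrite [X in X + _ <= _]big_mkcond [X in _ + X <= _]big_mkcond.
  rewrite [leRHS]big_mkcond -big_split/=; apply: ler_sum => k _.
  case: (B k); rewrite ?andbF ?andbT /= ?addr0//.
  have [ik|ki] := leP (r i) (r k); last by rewrite (lt_trans ki it) addr0.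
  rewrite add0r /=; have [kj|_] := leP (r k) (r j); last by case: ifP.
  by rewrite (le_lt_trans kj jt).
apply: le_trans (ler_wpM2l alpha0 Asplit) _.
apply: le_trans (ler_wpM2l beta0 Bsplit).
rewrite !mulrDr; apply: lerD => //; apply: IH.
rewrite -ltnS; apply: leq_trans tm; rewrite ltnS.
apply: proper_card; apply/properP; split.
  by apply/fintype.subsetP => k; rewrite !inE => /lt_trans; apply.
by exists i; rewrite !inE// ltxx.
Qed.

(** * Comparison of FIFO with a slower schedule *)

Section FifoVersusOpt.
Context {R : realType} (n : nat) (I : instance R n).
Variables (g : R -> R) (eps : R).
Hypothesis g_nondecreasing : forall t u, 0 <= t -> t <= u -> g t <= g u.
Hypothesis eps_gt0 : 0 < eps.
Local Notation r := (release I).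
Local Notation p := (proc I).

Variables (x : @rates R n) (C : 'I_n -> R).
Hypotheses (xF : fifo I x) (xC : completion_times I x C).
Variables (x' : @rates R n) (C' : 'I_n -> R).
Hypotheses (xS' : schedule (1 + eps)^-1 I x') (xC' : completion_times I x' C').

(* The window [r i, C j] of a busy period is filled by FIFO with the jobs
   released in [r i, r j].  The slower schedule completes only a fraction
   [(1 + eps)^-1] of them by [C j], and the others flow longer than [j] does
   under FIFO. *)
Lemma fifo_window y j : y <= g (C j - r j) -> exists2 i, r i <= r j &
  eps * \sum_(k | r i <= r k <= r j) p k <=
  (1 + eps) * \sum_(k | (r i <= r k <= r j) && (y <= g (C' k - r k))) p k.
Proof.
move=> yj; have [i rij busy] := fifo_busy_period xF xC j; exists i => //.
have [rC _ _] := xC j.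
have := completed_volume xS' (t := C j) (a := r i)
  (P := [pred k | (r i <= r k <= r j) && ~~ (y <= g (C' k - r k))]) xC'.
rewrite (le_trans rij rC) => /(_ isT) done.
rewrite (bigID (fun k => y <= g (C' k - r k)))/= in busy *.
set late := \sum_(k | _ && (y <= _)) p k in busy *.
set early := \sum_(k | _ && ~~ _) p k in busy done *.
have e1 : 0 < 1 + eps by rewrite addr_gt0.
(* A window job unfinished at [C j] in the slower schedule was released no later than [j], so it
   flows longer and its [g]-cost is at least [y]. *)
have : (1 + eps) * early <= C j - r i.
  rewrite -ler_pdivlMl//; apply: done => k /andP[/andP[-> rkj] late_k].
  split=> //; rewrite leNgt; apply: contra late_k => Ck.
  apply: le_trans yj _; apply: g_nondecreasing; first by rewrite subr_ge0.
  by apply: lerB; first exact: ltW.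
(* As [C j - r i <= late + early], this gives [eps * early <= late]; adding [eps * late] yields the
   claim. *)
move=> early_le; lra.
Qed.

Lemma fifo_cost_le :
  (forall t, 0 <= t -> 0 <= g t) -> equal_density I ->
  cost g I C <= (1 + eps) / eps * cost g I C'.
Proof.
move=> g_ge0 dens.
(* [d] is the common density, or 0 when there are no jobs. *)
have [d d0 wE] : exists2 d, 0 <= d & forall j, weight I j = d * p j.
  have [j _|no] := pickP (@predT 'I_n).
    exists (weight I j / p j) => [|k].
      by rewrite divr_ge0// ltW ?weight_gt0 ?proc_gt0.
    by rewrite (dens j k) divfK// gt_eqF ?proc_gt0.
  by exists 0 => // j; have := no j.
have costE D : cost g I D = d * \sum_k p k * g (D k - r k).
  by rewrite /cost mulr_sumr; apply: eq_bigr => k _; rewrite wE mulrA.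
rewrite !costE [leRHS]mulrCA ler_wpM2l// mulrAC ler_pdivlMr// mulrC.
have p0 k : 0 <= p k by apply/ltW/proc_gt0.
apply: weighted_level_le => // [k|k||y y0].
- by have [rC _ _] := xC k; rewrite g_ge0// subr_ge0.
- by have [rC _ _] := xC' k; rewrite g_ge0// subr_ge0.
- by rewrite addr_ge0// ltW.
apply: (window_cover_le (r := r)) => // [||j]; [exact: ltW | by rewrite addr_ge0// ltW |].
exact: fifo_window.
Qed.

End FifoVersusOpt.

Theorem theorem17 (R : realType) (g : R -> R)
  (g_ge0 : forall t, 0 <= t -> 0 <= g t)
  (g_nondecreasing : forall t u, 0 <= t -> t <= u -> g t <= g u)
  (g0 : g 0 = 0)
  (eps : R) (eps_gt0 : 0 < eps) :
  speed_competitive (@fifo R) (@equal_density R) g (1 + eps) ((1 + eps) / eps).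
Proof.
move=> n I dens; split; first exact: fifo_exists.
move=> x xF; split; first by case: xF.
have [C xC] := fifo_completion_times xF; exists C => //.
have beta0 : 0 < (1 + eps) / eps by rewrite divr_gt0// addr_gt0.
(* With the factor moved to the left, it suffices to bound each offline cost from below. *)
rewrite -lee_pdivrMl//; apply: le_ereal_inf_tmp => _ [C' [x' xS' xC'] <-].
rewrite -EFinM lee_fin ler_pdivrMl//.
exact: (fifo_cost_le g_nondecreasing eps_gt0 xF xC xS' xC').
Qed.
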